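(* Let $C$ be a minimal abstract clone. If $C$ has a nontrivial rectangular representation, then $C$ also has a nontrivial strongly abelian representation; moreover, all representations of $C$ are strongly abelian. Such a clone $C$ must be unary (generated by a unary operation), or (isomorphic to) the clone of rectangular bands.
   Context: A concrete clone is a composition-closed collection of finitary operations on some set containing all the projections. An abstract clone is a heterogeneous algebra (with one sort for each arity $n\ge 1$) having constants playing the role of projections and operations satisfying the usual identities of composition of concrete clones. A representation of an abstract clone $C$ is a clone homomorphism from $C$ into the concrete clone of all operations on a set $A$; it gives an algebra $\mathbb{A}$ on $A$ whose basic operations are the images of the elements of $C$ (equivalently, of a generating set of $C$). A clone is trivial if it consists of projections only, and minimal if it has exactly two subclones: itself and the clone of projections. An algebra is trivial if its clone of term operations is trivial; a representation is nontrivial, rectangular, or strongly abelian if the corresponding algebra is. For an algebra $\mathbb{A}$, let $\mathcal{M}(\mathbb{A})$ be the set of $2\times 2$ matrices $\begin{pmatrix} t(\mathbf{a},\mathbf{c}) & t(\mathbf{a},\mathbf{d}) \\ t(\mathbf{b},\mathbf{c}) & t(\mathbf{b},\mathbf{d}) \end{pmatrix}$ where $t$ is an $(n+m)$-ary polynomial operation of $\mathbb{A}$ and $\mathbf{a},\mathbf{b}\in A^n$, $\mathbf{c},\mathbf{d}\in A^m$. $\mathbb{A}$ is abelian if $\begin{pmatrix} u & u \\ v & w \end{pmatrix}\in\mathcal{M}(\mathbb{A})$ implies $v=w$; rectangular if $\begin{pmatrix} u & v \\ w & u \end{pmatrix}\in\mathcal{M}(\mathbb{A})$ implies $u=v=w$;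 strongly abelian if it is both abelian and rectangular. A rectangular band is an idempotent semigroup satisfying $xyz=xz$. The clone of rectangular bands is the clone of term operations of the countably generated free rectangular band. *)

(* Defs.v *)
From mathcomp Require Import all_boot.
From mathcomp Require Import boolp.

Set Implicit Arguments.
Unset Strict Implicit.
Unset Printing Implicit Defensive.

(* The sorts of a clone are the arities n >= 1; [cop C n] is the sort of the
   operations of arity n.+1. *)
Record clone := Clone {
  cop :> nat -> Type;
  cproj : forall n, 'I_n.+1 -> cop n;
  ccomp : forall m n, cop m -> ('I_m.+1 -> cop n) -> cop n;
  ccomp_projl : forall m n (i : 'I_m.+1) (g : 'I_m.+1 -> cop n),
    ccomp (cproj i) g = g i;
  ccomp_projr : forall n (f : cop n), ccomp f (@cproj n) = f;
  ccompA : forall l m n (f : cop l) (g : 'I_l.+1 -> cop m)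
      (h : 'I_m.+1 -> cop n),
    ccomp (ccomp f g) h = ccomp f (fun i => ccomp (g i) h)
}.

Arguments cproj {c n} i.
Arguments ccomp {c m n} f g.

Record clone_hom (C D : clone) := CloneHom {
  hom_fun :> forall n, C n -> D n;
  hom_proj : forall n (i : 'I_n.+1), hom_fun (cproj i) = cproj i;
  hom_comp : forall m n (f : C m) (g : 'I_m.+1 -> C n),
    hom_fun (ccomp f g) = ccomp (hom_fun f) (fun i => hom_fun (g i))
}.

Definition clone_isomorphic (C D : clone) : Prop :=
  exists (phi : clone_hom C D) (psi : clone_hom D C),
    (forall n (f : C n), psi n (phi n f) = f) /\
    (forall n (g : D n), phi n (psi n g) = g).

Definition opset (C : clone) := forall n, C n -> Prop.

Definition subclone (C : clone) (S : opset C) : Prop :=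
  (forall n (i : 'I_n.+1), S n (cproj i)) /\
  (forall m n (f : C m) (g : 'I_m.+1 -> C n),
     S m f -> (forall i, S n (g i)) -> S n (ccomp f g)).

Definition opset_eq (C : clone) (S T : opset C) : Prop :=
  forall n (f : C n), S n f <-> T n f.

Definition all_ops (C : clone) : opset C := fun _ _ => True.

Definition projections (C : clone) : opset C :=
  fun n f => exists i : 'I_n.+1, f = cproj i.

Inductive single (C : clone) (k : nat) (f : C k) : opset C :=
| single_refl : single f f.

Inductive generated (C : clone) (S : opset C) : opset C :=
| gen_base n (f : C n) : S n f -> generated S f
| gen_proj n (i : 'I_n.+1) : generated S (cproj i)
| gen_comp m n (f : C m) (g : 'I_m.+1 -> C n) :
    generated S f -> (forall i, generated S (g i)) -> generated S (ccomp f g).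

Definition trivial_clone (C : clone) : Prop :=
  opset_eq (@all_ops C) (@projections C).

(* Non-triviality says that the two subclones [all_ops] and [projections]
   are distinct. *)
Definition minimal_clone (C : clone) : Prop :=
  ~ trivial_clone C /\
  (forall S : opset C, subclone S ->
     opset_eq S (@all_ops C) \/ opset_eq S (@projections C)).

Definition unary_clone (C : clone) : Prop :=
  exists f : C 0, opset_eq (generated (single f)) (@all_ops C).

Lemma generated_subclone (C : clone) (S : opset C) : subclone (generated S).
Proof. by split=> *; [exact: gen_proj | exact: gen_comp]. Qed.

Section SubClone.
Variables (C : clone) (S : opset C) (hS : subclone S).

Let sop n := {f : C n | S f}.

Let sproj n (i : 'I_n.+1) : sop n := exist _ (cproj i) (hS.1 n i).

Let scomp m n (f : sop m) (g : 'I_m.+1 -> sop n) : sop n :=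
  exist _ (ccomp (sval f) (fun i => sval (g i)))
    (hS.2 m n _ _ (svalP f) (fun i => svalP (g i))).

Let sop_inj n (f g : sop n) : sval f = sval g -> f = g.
Proof.
case: f g => [f hf] [g hg] /= e; subst g.
by rewrite (Prop_irrelevance hf hg).
Qed.

Definition sub_clone : clone.
Proof.
apply: (@Clone sop sproj scomp).
- by move=> m n i g; apply: sop_inj; rewrite /= ccomp_projl.
- by move=> n f; apply: sop_inj; rewrite /= ccomp_projr.
- by move=> l m n f g h; apply: sop_inj; rewrite /= ccompA.
Defined.

End SubClone.

Definition full_clone (A : Type) : clone :=
  @Clone (fun n => ('I_n.+1 -> A) -> A)
    (fun n i x => x i)
    (fun m n f g x => f (fun i => g i x))
    (fun m n i g => erefl) (fun n f => erefl) (fun l m n f g h => erefl).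

Record algebra := Algebra {
  carrier :> Type;
  basic_op : opset (full_clone carrier)
}.

Definition term_clone (A : algebra) : clone :=
  sub_clone (generated_subclone (@basic_op A)).

Definition constant_op (A : Type) : opset (full_clone A) :=
  fun n f => exists a : A, f = fun _ => a.

Definition polynomial_op (A : algebra) : opset (full_clone A) :=
  generated (fun n f => basic_op f \/ constant_op f).

Definition trivial_algebra (A : algebra) : Prop :=
  trivial_clone (term_clone A).

Definition cat_args (A : Type) (n m k : nat) (e : n + m = k.+1)
    (a : 'I_n -> A) (c : 'I_m -> A) : 'I_k.+1 -> A :=
  fun i => match split (cast_ord (esym e) i) with
           | inl j => a j
           | inr j => c j
           end.

(* [in_M A u11 u12 u21 u22] is membership of the 2 x 2 matrix with these
   entries in M(A); the arity n + m of t must be positive, but n or m may be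
   zero. *)
Definition in_M (A : algebra) (u11 u12 u21 u22 : A) : Prop :=
  exists (n m k : nat) (e : n + m = k.+1) (t : full_clone A k)
         (a b : 'I_n -> A) (c d : 'I_m -> A),
    polynomial_op t /\
    [/\ u11 = t (cat_args e a c), u12 = t (cat_args e a d),
        u21 = t (cat_args e b c) & u22 = t (cat_args e b d)].

Definition abelian (A : algebra) : Prop :=
  forall u v w : A, in_M u u v w -> v = w.

Definition rectangular (A : algebra) : Prop :=
  forall u v w : A, in_M u v w u -> u = v /\ v = w.

Definition strongly_abelian (A : algebra) : Prop :=
  abelian A /\ rectangular A.

Definition representation (C : clone) (A : Type) := clone_hom C (full_clone A).

Definition rep_algebra (C : clone) (A : Type) (phi : representation C A) :
    algebra :=
  @Algebra A (fun n f => exists g : C n, f = phi n g).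

Record rect_band := RectBand {
  band_carrier :> Type;
  band_mul : band_carrier -> band_carrier -> band_carrier;
  band_mulA : forall x y z,
    band_mul x (band_mul y z) = band_mul (band_mul x y) z;
  band_mulxx : forall x, band_mul x x = x;
  band_mul_rect : forall x y z, band_mul (band_mul x y) z = band_mul x z
}.

Definition band_hom (E F : rect_band) (phi : E -> F) : Prop :=
  forall x y, phi (band_mul x y) = band_mul (phi x) (phi y).

Definition free_rect_band (X : Type) (F : rect_band) (gen : X -> F) : Prop :=
  forall (B : rect_band) (h : X -> B),
    exists! phi : F -> B, band_hom phi /\ (forall x, phi (gen x) = h x).

Definition band_mul_op (F : rect_band) : full_clone F 1 :=
  fun x => band_mul (x ord0) (x ord_max).

Definition band_algebra (F : rect_band) : algebra :=
  @Algebra F (single (@band_mul_op F)).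

(* The free rectangular band on countably many generators is determined only
   up to isomorphism, and so is its clone of term operations. *)
Definition isomorphic_to_rect_band_clone (C : clone) : Prop :=
  exists (F : rect_band) (gen : nat -> F),
    free_rect_band gen /\ clone_isomorphic C (term_clone (band_algebra F)).

(* Main.v *)
(* If C has a nontrivial unary operation, that operation generates C.
   Otherwise C is idempotent, and rectangularity of A says that the preimage of
   a point u under any operation of A is a box containing (u,..,u).  These boxes
   force A to have a nontrivial binary operation, and force every binary
   operation of A to satisfy ((xb)(cd))((ef)(gx)) = x.  Being an absorption
   identity, it lifts to the minimal clone C, and together with xx = x it defines
   rectangular bands; so C is generated by a rectangular band operation.
   In both cases every polynomial of a representation has the form
   P(x_i) * Q(x_j) with P, Q endomorphisms of a rectangular band (a left zero
   band in the unary case), which gives strong abelianness. *)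
Require Import Defs.
From mathcomp Require Import all_boot.
From mathcomp Require Import boolp.

Set Implicit Arguments.
Unset Strict Implicit.
Unset Printing Implicit Defensive.

(** * Subclones, generation and nontrivial representations *)

Lemma generated_sub (C : clone) (S T : opset C) :
  subclone T -> (forall n (f : C n), S n f -> T n f) ->
  forall n (f : C n), generated S f -> T n f.
Proof.
move=> [Tproj Tcomp] ST n f; elim=> {n f} [n f /ST //|n i|m n f g _ Tf _ Tg].
- exact: Tproj.
- exact: Tcomp.
Qed.

Lemma subclone_projections (C : clone) : subclone (@projections C).
Proof.
split=> [n i|m n f g [i ->] hg]; first by exists i.
by rewrite ccomp_projl; apply: hg.
Qed.

Lemma subclone_preim (C D : clone) (phi : clone_hom C D) (T : opset D) :
  subclone T -> subclone (fun n (f : C n) => T n (phi n f)).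
Proof.
move=> [Tproj Tcomp]; split=> [n i|m n f g Tf Tg].
- by rewrite hom_proj; apply: Tproj.
- by rewrite hom_comp; apply: Tcomp.
Qed.

Lemma minimal_generated (C : clone) n (f : C n) : minimal_clone C ->
  ~ projections f -> forall m (g : C m), generated (single f) g.
Proof.
move=> [_ hC] nf m g.
have [e|e] := hC _ (generated_subclone (single f)).
- by apply/e.
- by case: nf; apply/e/gen_base.
Qed.

Lemma sub_clone_inj (C : clone) (S : opset C) (hS : subclone S) n
  (f g : sub_clone hS n) : sval f = sval g -> f = g.
Proof.
case: f g => [f hf] [g hg] /= e; subst g.
by rewrite (Prop_irrelevance hf hg).
Qed.

Lemma nontrivial_rep (C : clone) (A : Type) (phi : representation C A) :
  ~ trivial_algebra (rep_algebra phi) ->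
  exists n (f : C n), ~ projections (phi n f).
Proof.
move=> ntriv; apply: contrapT => nex; apply: ntriv => n [f hf].
split=> // _; suff [i fi] : projections f.
  by exists i; apply: sub_clone_inj.
apply: generated_sub hf; first exact: subclone_projections.
move=> {f}m f [g ->]; apply: contrapT => ng; apply: nex.
by exists m, g.
Qed.

(* An absorption identity t = x_i holding in a nontrivial representation
   already holds in C: otherwise t generates C, and the representation would
   consist of projections. *)
Lemma absorption_lift (C : clone) (A : Type) (phi : representation C A) :
  minimal_clone C -> ~ trivial_algebra (rep_algebra phi) ->
  forall n (t : C n) (i : 'I_n.+1),
    (forall x, phi n t x = x i) -> t = cproj i.
Proof.
move=> hC /nontrivial_rep [m [f nf]] n t i ti.
have {}ti : phi n t = cproj i by apply/funext.
have [[j tj]|nt] := pselect (projections t); last first.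
  case: nf.
  apply: (generated_sub (subclone_preim phi (subclone_projections _)) _
    (minimal_generated hC nt f)) => k g [].
  by exists i.
rewrite tj; congr cproj; apply/eqP/negPn/negP => /eqP ji.
case: nf; exists ord0; apply/funext => x /=; move: (phi m f x) (x ord0) => a b.
have := congr1 (fun h : full_clone A n => h (fun l => if l == i then a else b)) ti.
by rewrite tj hom_proj /= eqxx; case: eqP.
Qed.

(** * Blocks of arguments and binary compositions *)

Lemma cat_args_lshift (A : Type) (n m : nat) (a : 'I_n.+1 -> A) (c : 'I_m -> A)
  (i : 'I_n.+1) :
  cat_args (erefl : n.+1 + m = (n + m).+1) a c (lshift m i) = a i.
Proof.
rewrite /cat_args; set k := cast_ord _ _.
have -> : k = lshift m i by apply: val_inj.
by have := unsplitK (inl i : 'I_n.+1 + 'I_m) => /= ->.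
Qed.

Lemma cat_args_rshift (A : Type) (n m : nat) (a : 'I_n.+1 -> A) (c : 'I_m -> A)
  (j : 'I_m) :
  cat_args (erefl : n.+1 + m = (n + m).+1) a c (rshift n.+1 j) = c j.
Proof.
rewrite /cat_args; set k := cast_ord _ _.
have -> : k = rshift n.+1 j by apply: val_inj.
by have := unsplitK (inr j : 'I_n.+1 + 'I_m) => /= ->.
Qed.

Definition pair2 (T : Type) (a b : T) : 'I_2 -> T :=
  fun i => if i == ord0 then a else b.

Definition mul2 (C : clone) (s : C 1) n (f g : C n) : C n :=
  ccomp s (pair2 f g).

Lemma pair2_comp (T U : Type) (h : T -> U) (a b : T) :
  (fun i => h (pair2 a b i)) = pair2 (h a) (h b).
Proof. by apply/funext => i; rewrite /pair2; case: ifP. Qed.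

Lemma ord2_max (i : 'I_2) : i != ord0 -> i = ord_max.
Proof. by case: i => [[|[|]]] //= lt _; apply: val_inj. Qed.

Lemma pair2_eta (T : Type) (x : 'I_2 -> T) : pair2 (x ord0) (x ord_max) = x.
Proof.
by apply/funext => i; rewrite /pair2; case: (eqVneq i ord0) => [->|/ord2_max ->].
Qed.

Lemma mul2_proj (C : clone) (s : C 1) :
  mul2 s (cproj ord0) (cproj ord_max) = s.
Proof. by rewrite /mul2 pair2_eta ccomp_projr. Qed.

Lemma comp_mul2 (C : clone) (s : C 1) m n (f g : C m) (h : 'I_m.+1 -> C n) :
  ccomp (mul2 s f g) h = mul2 s (ccomp f h) (ccomp g h).
Proof.
rewrite /mul2 ccompA; congr ccomp.
exact: (pair2_comp (fun f => ccomp f h)).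
Qed.

Lemma rep_mul2 (C : clone) (A : Type) (phi : representation C A) (s : C 1) n
  (f g : C n) x :
  phi n (mul2 s f g) x = phi 1 s (pair2 (phi n f x) (phi n g x)).
Proof.
rewrite /mul2 hom_comp /=; congr (phi 1 s).
exact: (pair2_comp (fun f => phi n f x)).
Qed.

(** [C] acts on its own [n]-ary operations, so a law valid in all representations also holds for the
    operations of [C]. *)
Definition cayley (C : clone) (n : nat) : representation C (C n).
Proof.
apply: (@CloneHom C (full_clone (C n)) (fun m f x => ccomp f x)).
- by move=> m i; apply/funext => x; rewrite ccomp_projl.
- by move=> k m f g; apply/funext => x; rewrite ccompA.
Defined.

(** * Idempotent rectangular representations *)

Section Rectangular.
Variables (C : clone) (A : Type) (phi : representation C A).
Hypothesis rect : rectangular (rep_algebra phi).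
Hypothesis idem : forall n (f : C n) a, phi n f (fun _ => a) = a.

(* Doubling the variables of f turns an arbitrary choice of coordinates into
   the two-block shape required by in_M. *)
Lemma rectangular_mix n (f : C n) (m : pred 'I_n.+1) (a b : 'I_n.+1 -> A) u :
  phi n f a = u -> phi n f b = u ->
  phi n f (fun i => if m i then a i else b i) = u.
Proof.
move=> fa fb.
pose t := ccomp f (fun i => if m i then cproj (lshift n.+1 i)
                            else cproj (rshift n.+1 i) : C (n + n.+1)).
have tE c d : phi _ t (cat_args (erefl : n.+1 + n.+1 = (n + n.+1).+1) c d) =
    phi n f (fun i => if m i then c i else d i).
  rewrite hom_comp /=; congr (phi n f); apply/funext => i.
  case: ifP => _; rewrite hom_proj /=.
  - exact: cat_args_lshift.
  - exact: cat_args_rshift.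
have mE c : (fun i => if m i then c i else c i) = c :> ('I_n.+1 -> A).
  by apply/funext => i; case: ifP.
have [//|<- _] := rect (u := u) (v := phi n f (fun i => if m i then a i else b i))
  (w := phi n f (fun i => if m i then b i else a i)) _ => //.
exists n.+1, n.+1, (n + n.+1), erefl, (phi _ t), a, b, a, b.
split; last by rewrite !tE !mE fa fb.
by apply: gen_base; left; exists t.
Qed.

(** By idempotence the constant tuple [u] lies in the preimage of [u], so it can be mixed with
    [a]. *)
Lemma rectangular_diag n (f : C n) (m : pred 'I_n.+1) (a : 'I_n.+1 -> A) u :
  phi n f a = u -> phi n f (fun i => if m i then a i else u) = u.
Proof. by move=> fa; apply: rectangular_mix. Qed.

Section Binary.
Variable s : C 1.
Local Notation "x * y" := (phi 1 s (pair2 x y)).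

Lemma rectangular_absorbr x y : (x * y) * y = x * y.
Proof.
have := rectangular_diag (pred1 ord_max) (erefl (x * y)).
set w := x * y; suff -> : (fun i => if pred1 ord_max i then pair2 x y i else w)
  = pair2 w y by [].
by apply/funext => - [[|[|k]] lt].
Qed.

Lemma rectangular_absorbl x y : x * (x * y) = x * y.
Proof.
have := rectangular_diag (pred1 ord0) (erefl (x * y)).
set w := x * y; suff -> : (fun i => if pred1 ord0 i then pair2 x y i else w)
  = pair2 x w by [].
by apply/funext => - [[|[|k]] lt].
Qed.

(** The box over [v] contains [(x,v)] and [(v,x)], hence [(x,x)], whose value is [x]. *)
Lemma rectangular_sym x v : x * v = v -> v * x = v -> x = v.
Proof.
move=> xv vx; have := rectangular_mix (pred1 ord0) xv vx.
have -> : (fun i => if pred1 ord0 i then pair2 x v i else pair2 v x i) = (fun=> x).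
  by apply/funext => - [[|[|k]] lt].
by rewrite idem.
Qed.

End Binary.
End Rectangular.

(** * The absorption identity on a binary tree with eight leaves *)

Local Notation "''o_' k" := (@Ordinal 8 k isT) (at level 8, k at level 2).

Definition tree8 (C : clone) (s : C 1) : C 7 :=
  mul2 s (mul2 s (mul2 s (cproj 'o_0) (cproj 'o_1))
                 (mul2 s (cproj 'o_2) (cproj 'o_3)))
         (mul2 s (mul2 s (cproj 'o_4) (cproj 'o_5))
                 (mul2 s (cproj 'o_6) (cproj 'o_7))).

Lemma rep_tree8 (C : clone) (A : Type) (phi : representation C A) (s : C 1) w :
  let mul x y := phi 1 s (pair2 x y) in
  phi 7 (tree8 s) w =
  mul (mul (mul (w 'o_0) (w 'o_1)) (mul (w 'o_2) (w 'o_3)))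
      (mul (mul (w 'o_4) (w 'o_5)) (mul (w 'o_6) (w 'o_7))).
Proof. by rewrite /= /tree8 !rep_mul2 !hom_proj. Qed.

Lemma rectangular_tree8 (C : clone) (A : Type) (phi : representation C A)
  (s : C 1) (w : 'I_8 -> A) :
  rectangular (rep_algebra phi) ->
  (forall n (f : C n) a, phi n f (fun _ => a) = a) ->
  w 'o_7 = w 'o_0 -> phi 7 (tree8 s) w = w 'o_0.
Proof.
move=> rect idem w70; set v := phi 7 _ w.
have idem2 a : phi 1 s (pair2 a a) = a.
  have -> : pair2 a a = fun=> a by apply/funext => i; rewrite /pair2 if_same.
  exact: idem.
apply/esym/(rectangular_sym rect idem (s := s)).
(* With [v] on all leaves but the first, where [x = w 'o_0] stays, the tree collapses to
   [((x v) v) v = x v]; hence [x v = v]. The last leaf dually gives [v x = v]. *)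
- have := rectangular_diag rect idem (pred1 'o_0) (erefl v).
  by rewrite rep_tree8 /= !idem2 !(rectangular_absorbr rect idem).
- have := rectangular_diag rect idem (pred1 'o_7) (erefl v).
  by rewrite rep_tree8 /= !idem2 !(rectangular_absorbl rect idem) w70.
Qed.

(** Given idempotence, the single law [(fg)(hk) = fk] amounts to associativity together with
    [fgh = fh]. *)
Definition rect_band_op (C : clone) (s : C 1) : Prop :=
  (forall n (f : C n), mul2 s f f = f) /\
  (forall n (f g h k : C n), mul2 s (mul2 s f g) (mul2 s h k) = mul2 s f k).

Lemma rect_band_of_absorption (B : Type) (m : B -> B -> B) :
  (forall x, m x x = x) ->
  (forall x b c d e f g,
     m (m (m x b) (m c d)) (m (m e f) (m g x)) = x) ->
  (forall x y z, m (m x y) z = m x z) /\ (forall x y z, m x (m y z) = m x z).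
Proof.
move=> mxx H.
have H2 x y z : m (m x y) (m z x) = x.
  by have := H x x y y z z x; rewrite !mxx.
(* [H2] reads [Y = (Yx)(zY)], so the two equations determine [Y]. *)
have E x z Y : m Y x = x -> m z Y = z -> Y = m x z.
  by move=> e1 e2; rewrite -[LHS](H2 Y x z) e1 e2.
(* The products xz, (xy)z and x(yz) all absorb x on the right and z on the left. *)
split=> x y z; apply: E.
- by have := H x y z z x x x; rewrite !mxx.
- by have := H z z z z x y z; rewrite !mxx.
- by have := H x x y z x x x; rewrite !mxx.
- by have := H z z z z x x y; rewrite !mxx.
Qed.

Lemma nontrivial_distinct_points (C : clone) (A : Type) (phi : representation C A) :
  ~ trivial_algebra (rep_algebra phi) -> exists x y : A, x <> y.
Proof.
move=> /nontrivial_rep [n [f nf]]; apply: contrapT => nxy; case: nf.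
exists ord0; apply/funext => x; apply: contrapT => ne; apply: nxy.
by do 2!eexists; exact: ne.
Qed.

(** * Minimal clones whose only unary operation is the projection *)

Section Idempotent.
Variables (C : clone) (A : Type) (phi : representation C A).
Hypothesis hC : minimal_clone C.
Hypothesis ntriv : ~ trivial_algebra (rep_algebra phi).
Hypothesis rect : rectangular (rep_algebra phi).
Hypothesis unary_triv : forall f : C 0, f = cproj ord0.

(** Identifying all variables of [f] gives a unary operation of [C], which must be the
    projection. *)
Lemma rep_idem (B : Type) (psi : representation C B) n (f : C n) b :
  psi n f (fun _ => b) = b.
Proof.
have := congr1 (fun g => psi 0 g (fun _ => b))
  (unary_triv (ccomp f (fun _ => cproj ord0))).
by rewrite hom_comp /= !hom_proj.
Qed.

Lemma rep_tree8_absorb (B : Type) (psi : representation C B) (s : C 1)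
  (w : 'I_8 -> B) : w 'o_7 = w 'o_0 -> psi 7 (tree8 s) w = w 'o_0.
Proof.
move=> w70.
(* Substituting [r] identifies the last variable with the first, so the tree becomes a term to which
   [absorption_lift] applies. *)
pose r : 'I_8 -> C 7 := fun i => if i == 'o_7 then cproj 'o_0 else cproj i.
have rE D (chi : representation C D) x : chi 7 (ccomp (tree8 s) r) x =
    chi 7 (tree8 s) (fun i => if i == 'o_7 then x 'o_0 else x i).
  rewrite hom_comp /=; congr (chi 7); apply/funext => i.
  by rewrite /r; case: ifP; rewrite hom_proj.
have t0 : ccomp (tree8 s) r = cproj 'o_0.
  apply: (absorption_lift hC ntriv) => x.
  by rewrite rE rectangular_tree8 //; apply: rep_idem.
have := rE B psi w; rewrite t0 hom_proj /= => ->; congr (psi 7).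
by apply/funext => i; case: eqP => // ->.
Qed.

Lemma rep_rect_band (B : Type) (psi : representation C B) (s : C 1) :
  let m x y := psi 1 s (pair2 x y) in
  (forall x, m x x = x) /\
  (forall x y z, m (m x y) z = m x z) /\ (forall x y z, m x (m y z) = m x z).
Proof.
move=> m; have mxx x : m x x = x.
  rewrite /m; have -> : pair2 x x = fun=> x.
    by apply/funext => i; rewrite /pair2 if_same.
  exact: rep_idem.
split=> //; apply: rect_band_of_absorption => // x b c d e f g.
pose w (i : 'I_8) := nth x [:: x; b; c; d; e; f; g; x] i.
have := @rep_tree8_absorb B psi s w erefl.
by rewrite rep_tree8.
Qed.

Lemma rect_band_op_idem (s : C 1) : rect_band_op s.
Proof.
split=> n; have [mxx [ml mr]] := rep_rect_band (cayley C n) s.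
- exact: mxx.
- by move=> f g h k; apply: etrans (ml f g (mul2 s h k)) (mr f h k).
Qed.

(* If all binary operations are trivial, then each f(y,..,x,..,y) is x or y.
   When it is x, the box property makes f a projection; when it is y for
   every position, the box f^-1(y) contains (x,..,x), a contradiction. *)
Lemma binary_nontrivial : exists s : C 1, ~ projections s.
Proof.
apply: contrapT => nex.
have bin (s : C 1) : s = cproj ord0 \/ s = cproj ord_max.
  have [[i ->]|ns] := pselect (projections s); last by case: nex; exists s.
  by case: (eqVneq i ord0) => [->|/ord2_max ->]; [left|right].
have [n [f nf]] := nontrivial_rep ntriv.
(* [F i] is [f(y,..,x,..,y)] with [x] in position [i]. *)
pose F i : C 1 := ccomp f (fun j => if j == i then cproj ord0 else cproj ord_max).
have FE i x y : phi 1 (F i) (pair2 x y) =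
    phi n f (fun j => if j == i then x else y).
  rewrite hom_comp /=; congr (phi n f); apply/funext => j.
  by case: ifP; rewrite hom_proj.
have [[i Fi]|nF] := pselect (exists i, F i = cproj ord0).
  case: nf; exists i; apply/funext => x; set u := phi n f x.
  have := rectangular_diag rect (@rep_idem _ phi) (pred1 i) (erefl u).
  have -> : (fun j => if pred1 i j then x j else u) =
      (fun j => if j == i then x i else u).
    by apply/funext => j /=; case: eqP => // ->.
  by rewrite -FE Fi hom_proj.
have {}nF i : F i = cproj ord_max.
  by have [e|//] := bin (F i); case: nF; exists i.
have [x [y]] := nontrivial_distinct_points ntriv; apply.
(* Positions turn from [y] to [x] one at a time: mixing the tuple with [x] below [k] and the tuple
   with [x] only at [k] stays in the box over [y]. *)
suff H k : phi n f (fun j => if j < k then x else y) = y.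
  rewrite -(H n.+1) -[LHS](rep_idem phi f); congr (phi n f).
  by apply/funext => j; rewrite ltn_ord.
elim: k => [|k IH]; first exact: rep_idem.
have [kn|kn] := ltnP k n.+1; last first.
  rewrite -[RHS]IH; congr (phi n f); apply/funext => j.
  by rewrite ltnS (leq_trans _ kn) ?(leq_trans (ltn_ord j) kn) // ltnW.
have e : phi n f (fun j => if j == Ordinal kn then x else y) = y.
  by rewrite -FE nF hom_proj.
rewrite -[RHS](rectangular_mix rect (fun j => j < k) IH e).
congr (phi n f); apply/funext => j; rewrite ltnS leq_eqVlt -val_eqE /=.
by case: ltnP => //; rewrite ?orbT ?orbF.
Qed.

End Idempotent.

(** * Split operations and strong abelianness *)

(* Taking P and Q to be endomorphisms makes this class closed under composition
   while still containing the constants. *)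
Definition split_op (E : rect_band) : opset (full_clone E) := fun n f =>
  exists (P Q : E -> E) (i j : 'I_n.+1),
    [/\ band_hom P, band_hom Q & forall x, f x = band_mul (P (x i)) (Q (x j))].

Lemma band_mul_outer (E : rect_band) (a b c d : E) :
  band_mul (band_mul a b) (band_mul c d) = band_mul a d.
Proof. by rewrite band_mul_rect band_mulA band_mul_rect. Qed.

Lemma subclone_split_op (E : rect_band) : subclone (@split_op E).
Proof.
split=> [n i|m n f g [P [Q [i [j [hP hQ fE]]]]] hg].
  by exists id, id, i, i; split=> // x; rewrite band_mulxx.
have [P1 [Q1 [i1 [j1 [hP1 hQ1 g1E]]]]] := hg i.
have [P2 [Q2 [i2 [j2 [hP2 hQ2 g2E]]]]] := hg j.
exists (P \o P1), (Q \o Q2), i1, j2; split=> [x y|x y|x] /=.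
- by rewrite hP1 hP.
- by rewrite hQ2 hQ.
- by rewrite fE g1E g2E hP hQ band_mul_outer.
Qed.

Lemma split_strongly_abelian (E : rect_band) (S : opset (full_clone E)) :
  (forall n (f : full_clone E n), S n f -> split_op f) ->
  strongly_abelian (Algebra S).
Proof.
move=> hS.
have poly n (t : full_clone E n) : @polynomial_op (Algebra S) n t -> split_op t.
  apply: generated_sub; first exact: subclone_split_op.
  move=> {n t}n t [/hS //|[a ->]].
  exists (fun=> a), (fun=> a), ord0, ord0.
  by split=> [x y|x y|x]; rewrite band_mulxx.
(* Here [xt = (xy)(zt) = uu = u]. *)
have mix (u x y z t : E) :
    u = band_mul x y -> u = band_mul z t -> band_mul x t = u.
  by move=> e1 e2; rewrite -(band_mul_outer x y z t) -e1 -e2 band_mulxx.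
(* Only the blocks containing [i] and [j] matter. If they coincide, the matrix has equal rows or
   equal columns; otherwise cancellation in the band is used. *)
split=> u v w [n [m [k [e [t [a [b [c [d [/poly [P [Q [i [j [_ _ tE]]]]]]]]]]]]]]];
  rewrite !tE /cat_args;
  case: (split (cast_ord (esym e) i)) => i'; case: (split (cast_ord (esym e) j)) => j'.
- by case=> _ _ -> ->.
- case=> e1 e2 -> ->.
  have mulr x y z : band_mul x (band_mul y z) = band_mul x z :> E.
    by rewrite -{1}(band_mulxx x) band_mul_outer.
  by rewrite -(mulr _ (P (a i')) (Q (c j'))) -e1 e2 mulr.
- case=> e1 e2 -> ->.
  by rewrite -(band_mul_rect _ (Q (a j'))) -e1 e2 band_mul_rect.
- by case=> -> -> -> ->.
- by case=> -> -> -> ->.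
- by case=> e1 -> -> e2; rewrite (mix _ _ _ _ _ e1 e2) (mix _ _ _ _ _ e2 e1).
- by case=> e1 -> -> e2; rewrite (mix _ _ _ _ _ e1 e2) (mix _ _ _ _ _ e2 e1).
- by case=> -> -> -> ->.
Qed.

Lemma split_rep_strongly_abelian (C : clone) (E : rect_band) k (f : C k)
  (phi : representation C E) :
  (forall n (g : C n), generated (single f) g) -> split_op (phi k f) ->
  strongly_abelian (rep_algebra phi).
Proof.
move=> hf hphi; apply: (@split_strongly_abelian E) => n _ [g ->].
apply: (generated_sub (subclone_preim phi (subclone_split_op E)) _ (hf n g)).
by move=> m h [].
Qed.

(** Every self-map is an endomorphism here, so every unary operation is split. *)
Definition left_zero_band (A : Type) : rect_band :=
  @RectBand A (fun x _ => x) (fun _ _ _ => erefl) (fun _ => erefl)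
    (fun _ _ _ => erefl).

Lemma unary_strongly_abelian (C : clone) (A : Type) (phi : representation C A)
  (f : C 0) : (forall n (g : C n), generated (single f) g) ->
  strongly_abelian (rep_algebra phi).
Proof.
move=> hf; apply: (@split_rep_strongly_abelian _ (left_zero_band A) _ _ _ hf).
exists (fun a => phi 0 f (fun _ => a)), id, ord0, ord0; split=> // x /=.
by congr (phi 0 f); apply/funext => i; rewrite ord1.
Qed.

Lemma band_strongly_abelian (C : clone) (A : Type) (phi : representation C A)
  (s : C 1) : (forall n (g : C n), generated (single s) g) ->
  let m x y := phi 1 s (pair2 x y) in
  (forall x, m x x = x) ->
  (forall x y z, m (m x y) z = m x z) -> (forall x y z, m x (m y z) = m x z) ->
  strongly_abelian (rep_algebra phi).
Proof.
move=> hs m mxx ml mr.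
have mA x y z : m x (m y z) = m (m x y) z by rewrite mr ml.
apply: (@split_rep_strongly_abelian _ (RectBand mA mxx ml) _ _ _ hs).
by exists id, id, ord0, ord_max; split=> // x; rewrite /= /m pair2_eta.
Qed.

(** * Clones generated by a rectangular band operation *)

Definition pair_op (C : clone) (s : C 1) n (p : 'I_n.+1 * 'I_n.+1) : C n :=
  mul2 s (cproj p.1) (cproj p.2).

Lemma comp_pair_op (C : clone) (s : C 1) m n (p : 'I_m.+1 * 'I_m.+1)
  (g : 'I_m.+1 -> C n) : ccomp (pair_op s p) g = mul2 s (g p.1) (g p.2).
Proof. by rewrite comp_mul2 !ccomp_projl. Qed.

Lemma rect_band_op_generated (C : clone) (s : C 1) : rect_band_op s ->
  forall n (f : C n), generated (single s) f -> exists p, f = pair_op s p.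
Proof.
move=> [mxx mout]; apply: generated_sub; first split=> [n i|m n f g [p ->] hg].
- by exists (i, i); rewrite /pair_op mxx.
- have [p1 e1] := hg p.1; have [p2 e2] := hg p.2; exists (p1.1, p2.2).
  by rewrite comp_pair_op e1 e2 mout.
- by move=> n f []; exists (ord0, ord_max); rewrite /pair_op mul2_proj.
Qed.

(** If two names of one operation differ in a coordinate, substituting one variable there and the
    other elsewhere, then multiplying by a projection, makes [s] a projection. *)
Lemma pair_op_inj (C : clone) (s : C 1) : rect_band_op s -> ~ projections s ->
  forall n, injective (@pair_op C s n).
Proof.
move=> [mxx mout] ns n [i j] [k l] e.
have ml f g h : mul2 s (mul2 s f g) h = mul2 s f h :> C 1.
  by rewrite -{1}(mxx _ h) mout.
have mr f g h : mul2 s f (mul2 s g h) = mul2 s f h :> C 1.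
  by rewrite -{1}(mxx _ f) mout.
congr pair.
- apply/eqP/negPn/negP => /negPf ik; case: ns; exists ord_max.
  have := congr1 (fun f => mul2 s (ccomp f (fun m => if m == i then cproj ord_max
    else cproj ord0 : C 1)) (cproj ord_max)) e.
  by rewrite !comp_pair_op /= !ml eqxx eq_sym ik mxx mul2_proj.
- apply/eqP/negPn/negP => /negPf jl; case: ns; exists ord0.
  have := congr1 (fun f => mul2 s (cproj ord0) (ccomp f (fun m => if m == j
    then cproj ord0 else cproj ord_max : C 1))) e.
  by rewrite !comp_pair_op /= !mr eqxx eq_sym jl mxx mul2_proj.
Qed.

Definition rect_band_generator (C : clone) (s : C 1) : Prop :=
  [/\ rect_band_op s, ~ projections s
    & forall n (f : C n), exists p, f = pair_op s p].

(** Each operation has a unique name [(i,j)], and names compose by the same rule in both clones, so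
    matching names is a homomorphism. *)
Lemma rect_band_generator_hom (C D : clone) (s : C 1) (t : D 1) :
  rect_band_generator s -> rect_band_generator t ->
  exists phi : clone_hom C D, forall n p, phi n (pair_op s p) = pair_op t p.
Proof.
move=> [hs ns gs] [[txx tout] nt gt].
have [c cE] : {c : forall n, C n -> 'I_n.+1 * 'I_n.+1 |
    forall n f, f = pair_op s (c n f)}.
  exists (fun n f => sval (cid (gs n f))) => n f; exact: svalP (cid (gs n f)).
have cK n p : c n (pair_op s p) = p by apply: (pair_op_inj hs ns); rewrite -cE.
pose F n (f : C n) := pair_op t (c n f).
have Fproj n (i : 'I_n.+1) : F n (cproj i) = cproj i.
  have e : cproj i = pair_op s (i, i) by rewrite /pair_op hs.1.
  by rewrite /F e cK /pair_op txx.
have Fcomp m n (f : C m) (g : 'I_m.+1 -> C n) :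
    F n (ccomp f g) = ccomp (F m f) (fun i => F n (g i)).
  rewrite /F comp_pair_op {1}(cE m f) comp_pair_op.
  set p := c m f; rewrite {1}(cE n (g p.1)) {1}(cE n (g p.2)) hs.2 tout.
  by rewrite -/(pair_op s (_, _)) cK.
by exists (CloneHom Fproj Fcomp) => n p; rewrite /= /F cK.
Qed.

Lemma rect_band_generator_iso (C D : clone) (s : C 1) (t : D 1) :
  rect_band_generator s -> rect_band_generator t -> clone_isomorphic C D.
Proof.
move=> hs ht; have [phi phiE] := rect_band_generator_hom hs ht.
have [psi psiE] := rect_band_generator_hom ht hs.
have [_ _ gs] := hs; have [_ _ gt] := ht.
exists phi, psi; split=> n f.
- by have [p ->] := gs n f; rewrite phiE psiE.
- by have [p ->] := gt n f; rewrite psiE phiE.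
Qed.

(** * The free rectangular band on countably many generators *)

Definition nat_band : rect_band :=
  @RectBand (nat * nat) (fun x y => (x.1, y.2)) (fun _ _ _ => erefl)
    (fun x => esym (surjective_pairing x)) (fun _ _ _ => erefl).

(** Since [(a,b)] is the product of the generators [(a,a)] and [(b,b)], a homomorphism is forced by
    its values on them. *)
Lemma nat_band_free : free_rect_band (fun n => (n, n) : nat_band).
Proof.
move=> B h; exists (fun x => band_mul (h x.1) (h x.2)); split.
- by split=> [x y|n]; rewrite ?band_mul_outer ?band_mulxx.
- move=> phi [phiM phi_gen]; apply/funext => -[a b] /=.
  by rewrite -!phi_gen -phiM.
Qed.

Definition nat_band_op : term_clone (band_algebra nat_band) 1 :=
  exist _ (@band_mul_op nat_band) (gen_base (single_refl _)).

Lemma nat_band_generator : rect_band_generator nat_band_op.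
Proof.
have mulE n (f g : term_clone (band_algebra nat_band) n) x :
  sval (mul2 nat_band_op f g) x = band_mul (sval f x) (sval g x) by [].
have hop : rect_band_op (@band_mul_op nat_band : full_clone nat_band 1).
  by split=> n *; apply/funext => x; rewrite /mul2 /= /band_mul_op /= -?surjective_pairing.
split.
- split=> n *; apply: sub_clone_inj; apply/funext => x; rewrite !mulE.
  + exact: band_mulxx.
  + exact: band_mul_outer.
(* The product of [(0,0)] and [(1,1)] is [(0,1)], distinct from both factors. *)
- move=> [i /(congr1 (fun f => sval f (pair2 (0, 0) (1, 1))))] /=.
  by rewrite /band_mul_op /pair2 /=; case: ifP.
- move=> n [f hf]; have [p e] := rect_band_op_generated hop hf.
  by exists p; apply: sub_clone_inj; rewrite /= e; apply/funext => x.
Qed.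

(** * The dichotomy by existence of a nontrivial unary operation *)

Theorem theorem5p4 (C : clone) (hmin : minimal_clone C)
    (hrect : exists (A : Type) (phi : representation C A),
       ~ trivial_algebra (rep_algebra phi) /\ rectangular (rep_algebra phi)) :
  (exists (A : Type) (phi : representation C A),
     ~ trivial_algebra (rep_algebra phi) /\
     strongly_abelian (rep_algebra phi)) /\
  (forall (A : Type) (phi : representation C A),
     strongly_abelian (rep_algebra phi)) /\
  (unary_clone C \/ isomorphic_to_rect_band_clone C).
Proof.
have [A [phi [ntriv rect]]] := hrect.
suff [sab cl] : (forall (A : Type) (phi : representation C A),
    strongly_abelian (rep_algebra phi)) /\
    (unary_clone C \/ isomorphic_to_rect_band_clone C).
  by split=> //; exists A, phi.
have [[f nf]|un] := pselect (exists f : C 0, f <> cproj ord0).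
  have genf : forall n (g : C n), generated (single f) g.
    by apply: minimal_generated => // -[i]; rewrite ord1.
  split=> [B psi|]; first exact: unary_strongly_abelian genf.
  by left; exists f => n g; split.
have {}un (f : C 0) : f = cproj ord0 by apply: contrapT => nf; case: un; exists f.
have [s ns] := binary_nontrivial ntriv rect un.
have gens := minimal_generated hmin ns.
have hs := rect_band_op_idem hmin ntriv rect un s.
split=> [B psi|]; last first.
  right; exists nat_band, (fun n => (n, n)); split; first exact: nat_band_free.
  apply: (rect_band_generator_iso _ nat_band_generator (s := s)); split=> // n f.
  exact: rect_band_op_generated.
have [mxx [ml mr]] := rep_rect_band hmin ntriv rect un psi s.
exact: band_strongly_abelian gens _ _ _.
Qed.
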